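(* For any permutations $u,v\in S_n$, $$\mathcal T_{u,v}=\{F_\bullet\in\mathrm{Fl}_n: P_w(F_\bullet)=0\text{ for all }w\in S_n\text{ with }w\notin[u,v]\},$$ and the corresponding open variety satisfies $\mathcal T^\circ_{u,v}=\mathcal T_{u,v}\cap\{P_uP_v\neq0\}$.
   Context: $[n]=\{1,\dots,n\}$. $\mathrm{Fl}_n$ is the variety of complete flags $F_\bullet=(0=F_0\subsetneq F_1\subsetneq\cdots\subsetneq F_n=\mathbb C^n)$. For $w\in S_n$, $w[k]:=\{w(1),\dots,w(k)\}$. For $S\subset[n]$, $\mathrm{Proj}_S:\mathbb C^n\to\mathbb C^{|S|}$ is the projection onto the coordinates indexed by $S$. Plücker coordinates: represent $F_\bullet$ by an invertible $n\times n$ matrix $M_F$ such that $F_k$ is the span of its first $k$ columns. For $I\in\binom{[n]}k$, $P_I(F_\bullet)$ is the minor of $M_F$ in the rows $I$ and the first $k$ columns (well defined up to a common nonzero scalar for each $k$). For $w\in S_n$, $P_w:=\prod_{k=1}^{n-1}P_{w[k]}$. Tilted Bruhat intervals: with $\ell(w)$ the number of inversions and $t_{ij}=(i\ j)$, the quantum Bruhat graph is the directed graph on $S_n$ with edges $w\to wt_{ij}$ ($i<j$) whenever $\ell(wt_{ij})=\ell(w)+1$ or $\ell(wt_{ij})=\ell(w)+1-2(j-i)$; $\ell(u,v)$ is the length of a shortest directed path from $u$ to $v$; and $[u,v]:=\{x\in S_n:\ell(u,x)+\ell(x,v)=\ell(u,v)\}$. Shifted orders: for $r\in[n]$, $\leq_r$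 is the linear order $r<_r r+1<_r\cdots<_r n<_r1<_r\cdots<_r r-1$ on $[n]$; for $A=\{a_1<_r\cdots<_r a_k\}$, $B=\{b_1<_r\cdots<_r b_k\}$, $A\leq_r B$ iff $a_i\leq_r b_i$ for all $i$. For $\mathbf a=(a_1,\dots,a_{n-1})\in[n]^{n-1}$ write $u\leq_{\mathbf a}v$ if $u[k]\leq_{a_k}v[k]$ for all $k\in[n-1]$. Cyclic intervals: $[a,b]_c=\{a,\dots,b\}$ if $1\le a\leq b\le n$; $[a,b]_c=\{a,\dots,n\}\cup\{1,\dots,b\}$ if $a>b\ge1$; $[a,0]_c=\{a,\dots,n\}$. Tilted Richardson varieties: for $u\leq_{\mathbf a}v$, $\mathcal T_{u,v,\mathbf a}$ is the set of $F_\bullet\in\mathrm{Fl}_n$ such that for all $i\in[n-1]$, $j\in[n]$: $\dim(\mathrm{Proj}_{[a_i,j]_c}(F_i))\leq\#(u[i]\cap[a_i,j]_c)$ and $\dim(\mathrm{Proj}_{[j,a_i-1]_c}(F_i))\leq\#(v[i]\cap[j,a_i-1]_c)$; $\mathcal T^\circ_{u,v,\mathbf a}$ is defined by the same conditions with $=$ in place of $\leq$. For every $u,v$ there is $\mathbf a$ with $u\leq_{\mathbf a}v$, and these sets do not depend on the choice of such $\mathbf a$; they are denoted $\mathcal T_{u,v}$ and $\mathcal T_{u,v}^\circ$. *)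

(* Defs.v *)
From HB Require Import structures.
From mathcomp Require Import all_boot all_order all_algebra all_fingroup.
From mathcomp Require Import classical_sets reals complex.
From mathcomp Require Import zify.

Set Implicit Arguments.
Unset Strict Implicit.
Unset Printing Implicit Defensive.

Import GRing.Theory.
Local Open Scope ring_scope.

(* Indexing.  An element x : 'I_n stands for the integer x + 1 of [n], and an
   index k : 'I_n.-1 stands for k + 1 in [n - 1].  Functions taking a nat
   argument for a size, a position in a flag or an endpoint of a cyclic interval
   use the usual 1-based values, so they are applied to x.+1 and k.+1. *)

Section Permutations.

Variable n : nat.
Implicit Types (u v w x : 'S_n) (A B S : {set 'I_n}).

Definition first_values w (k : nat) : {set 'I_n} :=
  [set w i | i : 'I_n & (i < k)%N].

Definition inv_number w : nat :=
  #|[set p : 'I_n * 'I_n | (p.1 < p.2)%N && (w p.2 < w p.1)%N]|.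

(* (s * t) x = t (s x) in MathComp, so w \o (i j), which exchanges the values of
   w at the positions i and j, is tperm i j * w. *)
Definition qbg_edge : rel 'S_n := fun w x =>
  [exists i : 'I_n, exists j : 'I_n,
    [&& (i < j)%N, x == (tperm i j * w)%g &
      (inv_number x == inv_number w + 1)%N
      || (inv_number x + 2 * (j - i) == inv_number w + 1)%N]].

Definition qbg_walk u v (m : nat) : bool :=
  [exists p : m.-tuple 'S_n, path qbg_edge u p && (last u p == v)].

Lemma inv_number_adjacent w (i j : 'I_n) : j = i.+1 :> nat -> (w i < w j)%N ->
  inv_number (tperm i j * w)%g = (inv_number w).+1.
Proof.
move=> ij wij; rewrite /inv_number.
have neij : (i == j) = false by apply/negP => /eqP e; move: ij; rewrite e; lia.
set t := tperm i j.
pose f (p : 'I_n * 'I_n) := (t p.1, t p.2).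
have fK : cancel f f by case=> a b; rewrite /f /= !tpermK.
set X := [set p | _ & _]; set Y := finset _.
have ijX : (i, j) \in X.
  by rewrite inE /= !permM tpermL tpermR wij andbT ij.
rewrite (cardsD1 (i, j)) ijX add1n; congr _.+1.
rewrite -(card_imset Y (can_inj fK)); apply: eq_card => p.
rewrite -[p]fK (mem_imset _ _ (can_inj fK)).
move: {p} (f p : 'I_n * 'I_n) => -[a b].
rewrite !inE /f /= !permM -/t !tpermK xpair_eqE.
have tE (c : 'I_n) : t c = if c == i then j else if c == j then i else c.
  by rewrite /t; case: tpermP => [->|->|/eqP/negPf-> /eqP/negPf->];
     rewrite ?eqxx // eq_sym neij.
have {neij} ji : (j == i) = false by rewrite eq_sym.
have oE (c d : 'I_n) : (c == d) = (c == d :> nat) by [].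
rewrite !tE; have [->|ai] := eqVneq a i; have [->|bi] := eqVneq b i.
- by rewrite !ltnn !andbF.
- have [->|bj] := eqVneq b j; first by move: wij; lia.
  by case: (w b < w i)%N; rewrite ?andbF // ji; move: bi bj; rewrite !oE; lia.
- have [->|aj] := eqVneq a j; first by rewrite !eqxx [X in _ = X && _]ltnNge ij leqnSn.
  by case: (w i < w a)%N; rewrite ?andbF //; move: ai aj; rewrite !oE; lia.
have [->|aj] := eqVneq a j; have [->|bj] := eqVneq b j.
- by rewrite !ltnn !andbF.
- by case: (w b < w j)%N; rewrite ?andbF //; move: bi bj; rewrite !oE; lia.
- by case: (w j < w a)%N; rewrite ?andbF //; move: ai aj; rewrite !oE; lia.
by rewrite (negPf ai).
Qed.

Lemma qbg_edge_adjacent w (i j : 'I_n) : j = i.+1 :> nat ->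
  qbg_edge w (tperm i j * w)%g.
Proof.
move=> ij; apply/existsP; exists i; apply/existsP; exists j.
rewrite ij ltnSn eqxx /= subSnn muln1 addn1; case: (ltngtP (w i) (w j)) => wij.
- by rewrite inv_number_adjacent ?eqxx.
- have := @inv_number_adjacent (tperm i j * w)%g i j ij.
  rewrite !permM tpermL tpermR mulgA tperm2 mul1g => /(_ wij) ->.
  by rewrite addn2 eqxx orbT.
by move/val_inj/perm_inj: wij ij => ->; lia.
Qed.

Lemma qbg_connected u v : exists m, qbg_walk u v m.
Proof.
pose conn u v := exists2 p, path qbg_edge u p & last u p = v.
have conn_refl x : conn x x by exists [::].
have conn_trans x y z : conn x y -> conn y z -> conn x z.
  move=> [p xp yp] [q yq zq]; exists (p ++ q); rewrite ?cat_path ?last_cat yp //.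
  by rewrite xp yq.
have conn_mul (s : 'S_n) (t : {perm 'I_n}) :
  (forall w, conn w (s * w)%g) -> (forall w, conn w (t * w)%g) ->
  forall w, conn w (s * t * w)%g.
  move=> cs ct w; apply: conn_trans (ct w) _; rewrite -mulgA; exact: cs.
have conn_tperm d : forall (i j : 'I_n), (j - i <= d)%N -> (i < j)%N ->
    forall w, conn w (tperm i j * w)%g.
  elim: d => [|d IHd] i j; first by lia.
  have [ij _ _ w|ij dij ltij] := eqVneq (j : nat) i.+1.
    by exists [:: (tperm i j * w)%g]; rewrite //= qbg_edge_adjacent.
  have kn : (i.+1 < n)%N by have := ltn_ord j; lia.
  pose k := Ordinal kn.
  have ik : i != k by rewrite -val_eqE /=; lia.
  have kj : k != j by rewrite -val_eqE /= eq_sym.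
  have -> : tperm i j = (tperm i k * tperm k j * tperm i k)%g.
    rewrite -{1}(tpermV i k) -mulgA -/(conjg _ _) tpermJ tpermR tpermD //.
    by move: ltij; rewrite -val_eqE /=; lia.
  have cik : forall w, conn w (tperm i k * w)%g.
    by move=> w; exists [:: (tperm i k * w)%g]; rewrite //= qbg_edge_adjacent.
  by apply: (conn_mul) => //; apply: (conn_mul) => //; apply: IHd => /=; lia.
have conn_tperm' i j w : conn w (tperm i j * w)%g.
  case: (ltngtP i j) => [ij|ji|/val_inj->]; first exact: (conn_tperm _ _ _ (leqnn _)).
    by rewrite tpermC; exact: (conn_tperm _ _ _ (leqnn _)).
  by rewrite tperm1 mul1g.
have conn_prod (ts : seq ('I_n * 'I_n)) w :
    conn w (\prod_(t <- ts) tperm t.1 t.2 * w)%g.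
  elim: ts w => [|t ts IH] w; first by rewrite big_nil mul1g.
  by rewrite big_cons; apply: (conn_mul) => {}w; [exact: conn_tperm'|exact: IH].
have [p up vp] : conn u v.
  by have [ts E _] := prod_tpermP (v * u^-1)%g; rewrite -(mulgKV u v) E.
by exists (size p); apply/existsP; exists (in_tuple p); rewrite up vp eqxx.
Qed.

Definition qbg_dist u v : nat := ex_minn (qbg_connected u v).

Definition tilted_interval u v : {set 'S_n} :=
  [set x | (qbg_dist u x + qbg_dist x v == qbg_dist u v)%N].

(* The position of x in r <_r r + 1 <_r ... <_r r - 1. *)
Definition shift_rank (r x : 'I_n) : nat := ((x + (n - r)) %% n)%N.

Definition shift_le (r : 'I_n) : rel 'I_n :=
  fun y z => (shift_rank r y <= shift_rank r z)%N.

Definition shift_sort (r : 'I_n) A : seq 'I_n := sort (shift_le r) (enum A).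

Definition set_shift_le (r : 'I_n) A B : bool :=
  all2 (shift_le r) (shift_sort r A) (shift_sort r B).

Definition tilted_le (a : 'I_n.-1 -> 'I_n) u v : bool :=
  [forall k : 'I_n.-1,
     set_shift_le (a k) (first_values u k.+1) (first_values v k.+1)].

Lemma all2_leq_count (s t : seq nat) : sorted leq s -> sorted leq t ->
  size s = size t ->
  (forall d, count (fun y => y < d)%N t <= count (fun y => y < d)%N s)%N ->
  all2 leq s t.
Proof.
elim: s t => [|y s IHs] [|z t] //= ys zt [st] le_ts.
have ls := order_path_min leq_trans ys; have lt := order_path_min leq_trans zt.
have yz : (y <= z)%N.
  have := le_ts z.+1; rewrite ltnSn add1n; have [//|zy] := leqP y z.
  rewrite ltnS (leqNgt y) zy add0n [X in (_ < X)%N](@eq_in_count _ _ pred0) ?count_pred0 //.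
  by move=> x /(allP ls) yx /=; lia.
rewrite yz; apply: IHs => // [||d]; [exact: path_sorted ys|exact: path_sorted zt|].
have [zd|dz] := ltnP z d.
  by have := le_ts d; rewrite zd (leq_ltn_trans yz zd) leq_add2l.
rewrite (@eq_in_count _ _ pred0) ?count_pred0 // => x /(allP lt) zx /=; lia.
Qed.

Lemma set_shift_le_exists A B : (0 < n)%N -> #|A| = #|B| ->
  exists r, set_shift_le r A B.
Proof.
move=> n_gt0 AB; pose c S t := (\sum_(y in S) (y < t)%N)%N.
pose D t := (c A t + (#|B| - c B t))%N.
have cS S t : (c S t <= #|S|)%N.
  by rewrite -sum1_card; apply: leq_sum => y _; case: ltnP.
have [r rmin] : exists r : 'I_n, forall t, (t < n)%N -> (D r <= D t)%N.
  pose r := [arg min_(t < Ordinal n_gt0) D t]%N; exists r => t tn.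
  by rewrite /r; case: arg_minnP => //= r0 _ /(_ (Ordinal tn) isT).
exists r; rewrite /set_shift_le.
pose rk := shift_rank r.
have rkE y : rk y = if (r <= y)%N then (y - r)%N else (y + n - r)%N.
  rewrite /rk /shift_rank; have := ltn_ord y; have := ltn_ord r.
  have [ry|ry] := leqP r y => rn yn; last by rewrite modn_small; lia.
  have -> : (y + (n - r) = y - r + n)%N by lia.
  by rewrite modnDr modn_small; lia.
have cntE S d : count (fun y => y < d)%N (map rk (shift_sort r S)) =
    (\sum_(y in S) (rk y < d)%N)%N.
  rewrite count_map /shift_sort count_sort -sum1_count.
  by rewrite big_enum_cond /= big_mkcondr; apply: eq_bigr => y _; case: ltnP.
have sS S : sorted leq (map rk (shift_sort r S)).
  by rewrite sorted_map; apply: sort_sorted => y z; exact: leq_total.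
have zS S : size (map rk (shift_sort r S)) = #|S|.
  by rewrite size_map size_sort -cardE.
have all2m s t : all2 leq (map rk s) (map rk t) = all2 (shift_le r) s t.
  by elim: s t => [|y s IHs] [|z t] //=; rewrite IHs.
have := @all2_leq_count _ _ (sS A) (sS B); rewrite !zS all2m => -> // d.
rewrite !cntE.
have [rdn|nrd] := leqP (r + d) n.
  have E S : ((\sum_(y in S) (rk y < d)%N) + c S r = c S (r + d))%N.
    rewrite -big_split; apply: eq_bigr => y _ /=; rewrite rkE.
    by have := ltn_ord y; have [] := leqP r y; lia.
  have : (D r <= D (r + d))%N.
    move: rdn; rewrite leq_eqVlt => /predU1P[->|]; last exact: rmin.
    have EN S : c S n = #|S|.
      by rewrite -sum1_card; apply: eq_bigr => y _; rewrite ltn_ord.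
    by apply: leq_trans (rmin 0 n_gt0) _; rewrite /D !EN /c !big1 //; lia.
  have := E A; have := E B; have := cS B r; have := cS B (r + d)%N; rewrite /D; lia.
have [dn|nd] := leqP d n.
  have E S : ((\sum_(y in S) (rk y < d)%N) + c S r = #|S| + c S (r + d - n))%N.
    rewrite -sum1_card -!big_split; apply: eq_bigr => y _ /=; rewrite rkE.
    by have := ltn_ord y; have := ltn_ord r; have [] := leqP r y; lia.
  have : (D r <= D (r + d - n))%N by apply: rmin; have := ltn_ord r; lia.
  have := E A; have := E B; have := cS B r; have := cS B (r + d - n)%N; rewrite /D; lia.
have E S : (\sum_(y in S) (rk y < d)%N)%N = #|S|.
  rewrite -sum1_card; apply: eq_bigr => y _ /=; rewrite rkE.
  by have := ltn_ord y; have := ltn_ord r; have [] := leqP r y; lia.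
by rewrite !E AB.
Qed.

Lemma tilted_le_exists u v : exists a, tilted_le a u v.
Proof.
have xr (k : 'I_n.-1) : exists r,
    set_shift_le r (first_values u k.+1) (first_values v k.+1).
  apply: set_shift_le_exists; first by have := ltn_ord k; lia.
  by rewrite !card_imset //; exact: perm_inj.
by exists (fun k => xchoose (xr k)); apply/forallP => k; exact: (xchooseP (xr k)).
Qed.

(* [a, b]_c for 1 <= a <= n and 0 <= b <= n; when b = 0 the second branch is
   {a, ..., n}, as it should be. *)
Definition cyclic_interval (a b : nat) : {set 'I_n} :=
  [set x : 'I_n | if (a <= b)%N then (a <= x.+1 <= b)%N
                  else (a <= x.+1)%N || (x.+1 <= b)%N].

End Permutations.

Section Flags.

Variables (K : fieldType) (n : nat).

Definition is_flag (F : {ffun 'I_n.+1 -> {vspace 'cV[K]_n}}) : bool :=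
  [&& F ord0 == 0%VS, F ord_max == fullv &
    [forall i : 'I_n, (F (inord i) <= F (inord i.+1))%VS
                      && (F (inord i) != F (inord i.+1))]].

Definition flag := {F : {ffun 'I_n.+1 -> {vspace 'cV[K]_n}} | is_flag F}.

Definition flag_space (F : flag) (k : nat) : {vspace 'cV[K]_n} :=
  val F (inord k).

Definition represents (F : flag) (M : 'M[K]_n) : bool :=
  (M \in unitmx)
  && [forall k : 'I_n.+1,
        flag_space F k == <<[seq col j M | j : 'I_n <- enum 'I_n & (j < k)%N]>>%VS].

Lemma represents_exists (F : flag) : exists M, represents F M.
Proof.
have /and3P[/eqP F0 /eqP Fn /forallP Fs] := valP F.
pose V k := flag_space F k.
have V0 : V 0 = 0%VS.
  by rewrite /V /flag_space -F0; congr (val F _);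
     apply/val_inj; rewrite /= inordK.
have Vn : V n = fullv.
  by rewrite /V /flag_space -Fn; congr (val F _);
     apply/val_inj; rewrite /= inordK.
have VS (i : 'I_n) : exists2 v, v \in V i.+1 & v \notin V i.
  have /andP[le_i ne_i] := Fs i.
  by apply/subvPn; apply: contra ne_i => ge_i; rewrite eqEsubv le_i.
have VSs (i : 'I_n) : (V i <= V i.+1)%VS by have /andP[] := Fs i.
have xv (i : 'I_n) : exists v, (v \in V i.+1) && (v \notin V i).
  by have [v v1 v2] := VS i; exists v; rewrite v1.
pose v i := xchoose (xv i).
have vP (i : 'I_n) : (v i \in V i.+1) && (v i \notin V i) := xchooseP (xv i).
pose M : 'M[K]_n := \matrix_(i, j) v j i 0.
have cM j : col j M = v j by apply/matrixP => i k; rewrite !mxE ord1.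
pose W k := (\sum_(j < n | (j < k)%N) <[v j]>)%VS.
have WE k : <<[seq col j M | j : 'I_n <- enum 'I_n & (j < k)%N]>>%VS = W k.
  rewrite span_def big_map big_filter big_enum_cond /=.
  by apply: eq_bigr => j _; rewrite cM.
have W0 : W 0 = 0%VS by rewrite /W big_pred0.
have WS (k : 'I_n) : W k.+1 = (W k + <[v k]>)%VS.
  rewrite /W (bigD1 k) //= addvC; congr (_ + _)%VS.
  by apply: eq_bigl => j; rewrite ltnS ltn_neqAle andbC -val_eqE.
have WV k : (k <= n)%N -> (W k <= V k)%VS.
  elim: k => [|k IHk] kn; first by rewrite W0 sub0v.
  rewrite (WS (Ordinal kn)) subv_add (subv_trans (IHk (ltnW kn)) (VSs (Ordinal kn))).
  by have /andP[] := vP (Ordinal kn).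
have dW k : (k <= n)%N -> \dim (W k) = k.
  elim: k => [|k IHk] kn; first by rewrite W0 dimv0.
  have /andP[_ nv] := vP (Ordinal kn).
  have nW : v (Ordinal kn) \notin W k by apply: contra nv => /(subvP (WV _ (ltnW kn))).
  rewrite (WS (Ordinal kn)) dimv_disjoint_sum ?IHk 1?ltnW //=.
    rewrite dim_vline; case: eqP nW => [->|_ _]; last by rewrite addn1.
    by rewrite mem0v.
  apply/eqP; rewrite -subv0; apply/subvP => x /memv_capP[xW /vlineP[c xE]].
  have [c0|c0] := eqVneq c 0; first by rewrite xE c0 scale0r mem0v.
  by case/negP: nW; move: xW; rewrite xE rpredZeq (negPf c0).
have dV k : (k <= n)%N -> (\dim (V k) <= k)%N.
  move=> kn; suff : (\dim (V k) + (n - k) <= n)%N by lia.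
  have : forall d, (k + d <= n)%N -> (\dim (V k) + d <= \dim (V (k + d)))%N.
    elim=> [|d IHd] kd; first by rewrite !addn0.
    rewrite !addnS; have kd' : (k + d < n)%N by lia.
    apply: leq_ltn_trans (IHd (ltnW kd')) _.
    have /andP[le_i ne_i] := Fs (Ordinal kd').
    rewrite ltn_neqAle (dimvS le_i) andbT; apply: contra ne_i => /eqP dE.
    rewrite eqEdim le_i; move: dE; rewrite /V /flag_space => ->; exact: leqnn.
  move/(_ (n - k)%N); rewrite subnKC // => /(_ (leqnn _)).
  by rewrite Vn dimvf /dim /= muln1.
have WVE k : (k <= n)%N -> V k = W k.
  move=> kn; apply/esym/eqP; rewrite eqEdim WV // dW // dV //.
exists M; apply/andP; split; last first.
  by apply/forallP => k; rewrite WE -/(V k) WVE // -ltnS.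
pose X := [tuple col j M | j < n].
have XE : <<X>>%VS = fullv.
  rewrite -Vn WVE // -WE; congr span; rewrite /= enumT -enumT.
  by congr map; apply/esym/all_filterP/allP => j _.
have cX w : w = \sum_(i < n) coord X i w *: col i M.
  rewrite {1}(@coord_span _ _ _ X w) ?XE ?memvf //.
  by apply: eq_bigr => i _; rewrite -tnth_nth tnth_mktuple.
pose B : 'M[K]_n := \matrix_(i, j) coord X i (delta_mx j 0).
suff /mulmx1_unit[] : M *m B = 1%:M by [].
apply/matrixP => i j; have /matrixP/(_ i 0) := cX (delta_mx j 0).
rewrite !mxE eqxx andbT summxE => ->; apply: eq_bigr => l _.
by rewrite !mxE mulrC.
Qed.

(* Any representative will do, by minor_represents below. *)
Definition flag_mx (F : flag) : 'M[K]_n := xchoose (represents_exists F).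

Lemma card_set_ord (I : {set 'I_n}) : (#|I| <= n)%N.
Proof. by rewrite -[n in leqRHS]card_ord max_card. Qed.

(* enum_val lists I in increasing order. *)
Definition minor (M : 'M[K]_n) (I : {set 'I_n}) : K :=
  \det (mxsub (fun i : 'I_#|I| => enum_val i) (widen_ord (card_set_ord I)) M).

Lemma minor_represents (F : flag) (M M' : 'M[K]_n) (k : nat) :
  represents F M -> represents F M' ->
  exists2 c, c != 0 &
    forall I : {set 'I_n}, #|I| = k -> minor M I = minor M' I * c.
Proof.
have [kn|nk] := leqP k n; last first.
  move=> _ _; exists 1; rewrite ?oner_eq0 // => I Ik.
  by have := card_set_ord I; rewrite Ik leqNgt nk.
pose g := widen_ord kn.
have colP (M1 M2 : 'M[K]_n) : represents F M1 -> represents F M2 ->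
    forall (j : 'I_k) (l : 'I_n), (k <= l)%N -> (invmx M2 *m M1) l (g j) = 0.
  move=> /andP[_ /forallP S1] /andP[u2 /forallP S2] j l kl.
  have kn1 : (k < n.+1)%N by [].
  have /eqP := S1 (Ordinal kn1); rewrite (eqP (S2 (Ordinal kn1))) /= => S12.
  have : col (g j) M1 \in <<[seq col j M1 | j : 'I_n <- enum 'I_n & (j < k)%N]>>%VS.
    by apply/memv_span/map_f; rewrite mem_filter mem_enum /= ltn_ord.
  rewrite -S12 span_def big_map big_filter big_enum_cond /=.
  case/memv_sumP => f fP /(congr1 (mulmx (invmx M2))).
  rewrite colE mulmxA -colE => /matrixP/(_ l 0); rewrite mxE => ->.
  rewrite mulmx_sumr summxE big1 // => i ik.
  have /vlineP[c ->] := fP i ik.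
  rewrite -scalemxAr colE mulmxA -colE mulVmx // !mxE.
  case: eqP => [li|]; last by rewrite mulr0.
  by move: ik; rewrite -li ltnNge kl.
have mulP (M1 M2 : 'M[K]_n) m (h : 'I_m -> 'I_n) (N : 'M_n) :
    represents F M1 -> represents F M2 ->
    mxsub h g (N *m (invmx M2 *m M1)) = mxsub h g N *m mxsub g g (invmx M2 *m M1).
  move=> r1 r2; apply/matrixP => i j; rewrite !mxE.
  rewrite (bigID (fun l : 'I_n => (l < k)%N)) /= [X in _ + X]big1 ?addr0 => [|l].
    by rewrite (big_ord_narrow kn); apply: eq_bigr => l _; rewrite !mxE.
  by rewrite -leqNgt => kl; rewrite (colP M1 M2) // mulr0.
move=> rM rM'; have /andP[uM _] := rM; have /andP[uM' _] := rM'.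
exists (\det (mxsub g g (invmx M' *m M))).
  apply/eqP => d0; have := mulP M M' k g (invmx M *m M') rM rM'.
  rewrite mulmxA mulmxK // mulVmx // => /(congr1 determinant).
  rewrite det_mulmx d0 mulr0 => /eqP; have -> : mxsub g g 1%:M = 1%:M :> 'M[K]_k.
    by apply/matrixP => i j; rewrite !mxE -!val_eqE.
  by rewrite det1 oner_eq0.
move=> I Ik; subst k.
rewrite /minor (bool_irrelevance (card_set_ord I) kn) -/g.
rewrite -det_mulmx -mulP //.
by rewrite mulKVmx.
Qed.

Definition plucker (F : flag) (I : {set 'I_n}) : K := minor (flag_mx F) I.

Definition plucker_perm (F : flag) (w : 'S_n) : K :=
  \prod_(k < n.-1) plucker F (first_values w k.+1).

Definition dim_proj (S : {set 'I_n}) (U : {vspace 'cV[K]_n}) : nat :=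
  \dim (linfun (rowsub (fun i : 'I_#|S| => enum_val i)) @: U)%VS.

(* Meaningful only when tilted_le a u v; such an a always exists, by
   tilted_le_exists. *)
Definition tilted_richardson (u v : 'S_n) (a : 'I_n.-1 -> 'I_n) : set flag :=
  [set F | forall (i : 'I_n.-1) (j : 'I_n),
     let: A := cyclic_interval n (a i).+1 j.+1 in
     let: B := cyclic_interval n j.+1 (a i) in
     (dim_proj A (flag_space F i.+1) <= #|first_values u i.+1 :&: A|)%N /\
     (dim_proj B (flag_space F i.+1) <= #|first_values v i.+1 :&: B|)%N]%classic.

Definition open_tilted_richardson (u v : 'S_n) (a : 'I_n.-1 -> 'I_n) :
    set flag :=
  [set F | forall (i : 'I_n.-1) (j : 'I_n),
     let: A := cyclic_interval n (a i).+1 j.+1 in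
     let: B := cyclic_interval n j.+1 (a i) in
     dim_proj A (flag_space F i.+1) = #|first_values u i.+1 :&: A| /\
     dim_proj B (flag_space F i.+1) = #|first_values v i.+1 :&: B|]%classic.

End Flags.

(* Main.v *)
Require Import Defs.
From HB Require Import structures.
From mathcomp Require Import classical_sets reals complex.
From mathcomp Require Import all_boot all_order all_algebra all_fingroup.
From mathcomp Require Import zify.

(** Write F_A(s) for the number of elements of A below s.  For subsets A and B of
    the same size, A <=_r B holds exactly when F_B - F_A attains its maximum over
    [0, n] at the boundary r just before the element r.  That maximum, [depth A B],
    counts how often elements must pass from n to 1 when A is moved to B by going
    up along the circle; it satisfies the triangle inequality.

    An edge w -> w t_ij of the quantum Bruhat graph moves the value w(i) up along
    the circle to w(j) in each set w[k] with i <= k < j, without meeting the values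
    at the positions in between.  Comparing inversions with depths gives the
    distance formula
      l(u,v) = inv v - inv u + 2 sum_k depth(u[k], v[k])       [qbg_dist_depth].
    No walk is shorter because every edge satisfies the formula and depth is
    subadditive.  A walk of this length exists because of [qbg_step]: take the
    first position i where u and v differ and swap it with the first later
    position whose value lies in the cyclic interval from u(i) to v(i); a count in
    this interval shows that the depths then add up exactly.  Consequently
    w is in [u,v] iff depth(u[k],w[k]) + depth(w[k],v[k]) = depth(u[k],v[k]) for all
    k.  When u <=_a v the right-hand side is the value of F_(v[k]) - F_(u[k]) at
    a_k, and the equality says that both summands are attained at a_k as well, that
    is, u <=_a w <=_a v [tilted_intervalP].

    On the geometric side, let N_k be the matrix of a flag with all columns after
    the k-th set to zero.  The sets I of size k with P_I <> 0 are the bases of the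
    matroid of rows of N_k, and the projection of F_k to the coordinates S has as
    dimension the rank of S, the largest size of the intersection of S with a
    basis.  So the rank conditions of the tilted Richardson variety say that
    every basis I of F_k satisfies u[k] <=_(a_k) I <=_(a_k) v[k]
    [tilted_richardsonP].  Hence P_w vanishes on the variety unless w is in [u,v].
    Conversely every basis of F_k is w[k] for some w with P_w <> 0, since bases can
    be shrunk to bases of F_(k-1) and enlarged to bases of F_(k+1)
    [flag_basis_perm]; if P_w vanishes off [u,v] then w is in [u,v] and the basis
    satisfies the two inequalities.

    On the variety the rank conditions are equalities when u[k] and v[k] are bases.
    In the other direction, a set that meets each member of a full chain of sets
    in as many elements as the rank of that member is the one a greedy choice
    produces, so it is a basis [greedy_row_free]; the cyclic intervals starting
    at a_k, and those ending just before it, form such chains. *)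

Set Implicit Arguments.
Unset Strict Implicit.
Unset Printing Implicit Defensive.

Import GRing.Theory.

(** * Counting functions of subsets of a cyclically ordered set *)

Section Counting.

Variable n : nat.
Implicit Types (A B C : {set 'I_n}) (r s : nat).

Definition card_lt A r : nat := \sum_(y in A) (y < r)%N.

Lemma card_setI A (P : pred 'I_n) : #|A :&: [set y | P y]| = \sum_(y in A) P y.
Proof.
rewrite -sum1_card big_mkcond [RHS]big_mkcond; apply: eq_bigr => y _.
by rewrite !inE; case: (y \in A); case: (P y).
Qed.

Lemma card_lt0 A : card_lt A 0 = 0.
Proof. exact: big1. Qed.

Lemma card_lt_all A r : (n <= r)%N -> card_lt A r = #|A|.
Proof.
move=> nr; rewrite -sum1_card; apply: eq_bigr => y _.
by rewrite (leq_trans (ltn_ord y) nr).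
Qed.

Lemma card_cyclic_interval A a b :
  (#|A :&: cyclic_interval n a.+1 b| + card_lt A a
   = card_lt A b + if (a < b)%N then 0 else #|A|)%N.
Proof.
rewrite card_setI; case: ifP => ab; last rewrite -sum1_card.
  rewrite addn0 -big_split; apply: eq_bigr => y _ /=; lia.
rewrite -!big_split; apply: eq_bigr => y _ /=; lia.
Qed.

(** The function F_B - F_A is maximal at [r].  The comparison is written with sums
    to stay in the natural numbers. *)
Definition count_le r A B : Prop :=
  forall s, (s <= n)%N ->
    (card_lt B s + card_lt A r <= card_lt B r + card_lt A s)%N.

Lemma shift_rankE (r y : 'I_n) :
  shift_rank r y = if (r <= y)%N then (y - r)%N else (y + n - r)%N.
Proof.
rewrite /shift_rank; have := ltn_ord y; have := ltn_ord r.
have [ry|ry] := leqP r y => rn yn; last by rewrite modn_small; lia.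
have -> : (y + (n - r) = y - r + n)%N by lia.
by rewrite modnDr modn_small; lia.
Qed.

Lemma ltn_shift_rank (r y : 'I_n) : (shift_rank r y < n)%N.
Proof. by rewrite ltn_mod; have := ltn_ord r; lia. Qed.

Lemma shift_rank_inj (r : 'I_n) : injective (shift_rank r).
Proof.
move=> x y E; apply/val_inj; move: E (ltn_ord r) (ltn_ord x) (ltn_ord y).
by rewrite !shift_rankE /=; do 2! case: ifP; lia.
Qed.

Lemma cyclic_interval_initial (r j : 'I_n) :
  cyclic_interval n r.+1 j.+1 = [set x | (shift_rank r x <= shift_rank r j)%N].
Proof.
apply/setP => x; rewrite !inE !shift_rankE.
by have := ltn_ord r; have := ltn_ord x; have := ltn_ord j; do ! case: ifP; lia.
Qed.

Lemma cyclic_interval_final (r j : 'I_n) :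
  cyclic_interval n j.+1 r = [set x | (shift_rank r j <= shift_rank r x)%N].
Proof.
apply/setP => x; rewrite !inE !shift_rankE.
by have := ltn_ord r; have := ltn_ord x; have := ltn_ord j; do ! case: ifP; lia.
Qed.

(** Comparing the sorted lists entry by entry bounds, for each d, the number of
    elements of B among the first d of the shifted order by that of A.  For
    d = s - r modulo n the first d elements are those from r to s - 1, so the two
    numbers are differences of the counting functions at s and r, up to the common
    cardinality when the interval wraps. *)
Lemma set_shift_le_count (r : 'I_n) A B :
  #|A| = #|B| -> set_shift_le r A B -> count_le r A B.
Proof.
move=> cAB leAB s sn; pose rk := shift_rank r.
have rkE y : rk y = _ := shift_rankE r y.
pose rank_lt (S : {set 'I_n}) d : nat := \sum_(y in S) (rk y < d)%N.
have le_rank d : (rank_lt B d <= rank_lt A d)%N.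
  have rank_ltE S : rank_lt S d = count (fun y => rk y < d)%N (shift_sort r S).
    rewrite count_sort -sum1_count big_enum_cond /= big_mkcondr.
    by apply: eq_bigr => y _; case: ltnP.
  rewrite !rank_ltE; move: leAB; rewrite /set_shift_le.
  elim: (shift_sort r A) (shift_sort r B) => [|y p IHp] [|z q] //= /andP[yz pq].
  by apply: leq_add (IHp _ pq); move: yz; rewrite /shift_le -/rk /rk; lia.
have rn := ltn_ord r.
have [rs|sr] := leqP r s.
  have E S : (rank_lt S (s - r) + card_lt S r = card_lt S s)%N.
    rewrite -big_split; apply: eq_bigr => y _ /=; rewrite rkE.
    by have := ltn_ord y; case: (leqP r y); lia.
  have := le_rank (s - r)%N; have := E A; have := E B; lia.
have E S : (rank_lt S (n - r + s) + card_lt S r = #|S| + card_lt S s)%N.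
  rewrite -sum1_card -!big_split; apply: eq_bigr => y _ /=; rewrite rkE.
  by have := ltn_ord y; case: (leqP r y); lia.
have := le_rank (n - r + s)%N; have := E A; have := E B; lia.
Qed.

(** This and the next lemma turn the two families of rank conditions into order
    relations: the elements of A in a cyclic interval are counted by a difference of
    values of F_A, where one of the endpoints is the boundary before [r]. *)
Lemma count_le_initial (r : 'I_n) A B : #|A| = #|B| ->
  count_le r A B <->
  forall j : 'I_n, (#|B :&: cyclic_interval n r.+1 j.+1|
                    <= #|A :&: cyclic_interval n r.+1 j.+1|)%N.
Proof.
move=> cAB; split=> [le j|le s sn].
  have := le j.+1 (ltn_ord j).
  have := card_cyclic_interval A r j.+1; have := card_cyclic_interval B r j.+1.
  case: ifP; lia.
wlog s0 : s sn / (0 < s)%N => [IH|].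
  case: s sn => [|s] sn; last exact: IH.
  have nn : (0 < n)%N by have := ltn_ord r; lia.
  have := IH n (leqnn n) nn.
  by rewrite !(card_lt_all _ (leqnn n)) !card_lt0; lia.
case: s sn s0 => // s sn _; have leS : (#|B :&: cyclic_interval n r.+1 s.+1|
                    <= #|A :&: cyclic_interval n r.+1 s.+1|)%N := le (Ordinal sn).
have := card_cyclic_interval A r s.+1; have := card_cyclic_interval B r s.+1.
case: ifP; lia.
Qed.

Lemma count_le_final (r : 'I_n) A B : #|A| = #|B| ->
  count_le r A B <->
  forall j : 'I_n, (#|A :&: cyclic_interval n j.+1 r|
                    <= #|B :&: cyclic_interval n j.+1 r|)%N.
Proof.
move=> cAB; split=> [le j|le s sn].
  have := le j (ltnW (ltn_ord j)).
  have := card_cyclic_interval A j r; have := card_cyclic_interval B j r.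
  case: ifP; lia.
wlog s0 : s sn / (s < n)%N => [IH|].
  move: sn; rewrite leq_eqVlt => /predU1P[->|sn]; last exact: IH (ltnW sn) sn.
  have nn : (0 < n)%N by have := ltn_ord r; lia.
  have := IH 0 (leq0n n) nn.
  by rewrite !(card_lt_all _ (leqnn n)) !card_lt0; lia.
have leS : (#|A :&: cyclic_interval n s.+1 r|
            <= #|B :&: cyclic_interval n s.+1 r|)%N := le (Ordinal s0).
have := card_cyclic_interval A s r; have := card_cyclic_interval B s r.
case: ifP; lia.
Qed.

(** The least exponent of a quantum parameter: the number of times the boundary
    between n and 1 must be crossed to move A up to B.  Truncated subtraction is
    harmless since the term at s = 0 vanishes; including s = n makes the bound
    [leq_depth] available at every right end of an interval. *)
Definition depth A B : nat := \max_(s < n.+1) (card_lt B s - card_lt A s).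

Lemma leq_depth A B s : (s <= n)%N -> (card_lt B s - card_lt A s <= depth A B)%N.
Proof.
by move=> sn; rewrite /depth (bigmax_sup (Ordinal (sn : (s < n.+1)%N))).
Qed.

Lemma depth_leqP A B d :
  reflect (forall s, (s <= n)%N -> (card_lt B s <= d + card_lt A s)%N)
          (depth A B <= d)%N.
Proof.
apply: (iffP (bigmax_leqP _ _ _)) => [le s sn|le s _].
  by have := le (Ordinal (sn : (s < n.+1)%N)) isT => /=; lia.
by have := le s; have := ltn_ord s; lia.
Qed.

Lemma depth_refl A : depth A A = 0%N.
Proof. by apply/eqP; rewrite -leqn0; apply/depth_leqP. Qed.

Lemma depth_triangle B A C : (depth A C <= depth A B + depth B C)%N.
Proof.
by apply/depth_leqP => s sn; have := leq_depth A B sn; have := leq_depth B C sn; lia.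
Qed.

(** The maximum of a sum of two functions is the sum of their maxima only if both
    are maximal at each point where the sum is. *)
Lemma depth_between r A B C : (r <= n)%N -> count_le r A C ->
  (depth A B + depth B C == depth A C)%N <-> count_le r A B /\ count_le r B C.
Proof.
move=> rn AC; have zero S : card_lt S 0 = 0 by rewrite /card_lt big1.
have max S T : count_le r S T -> (depth S T + card_lt S r = card_lt T r)%N.
  move=> ST; have := ST 0 (leq0n n); rewrite !card_lt0 => ST0.
  suff : (depth S T <= card_lt T r - card_lt S r)%N.
    by have := leq_depth S T rn; lia.
  by apply/depth_leqP => s /ST; lia.
split=> [/eqP E|[/max AB /max BC]]; last by have := max _ _ AC; lia.
have ACE := max _ _ AC.
have := leq_depth A B rn; have := leq_depth B C rn.
split=> s sn.
  by have := leq_depth A B sn; lia.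
by have := leq_depth B C sn; lia.
Qed.

End Counting.

(** * The distance in the quantum Bruhat graph *)

Section QuantumBruhat.

Variable n : nat.
Implicit Types u v w x : 'S_n.

Lemma first_valuesP w k y :
  reflect (exists2 m : 'I_n, (m < k)%N & y = w m) (y \in first_values w k).
Proof. by apply: (iffP imsetP) => -[m mk ->]; exists m; rewrite // inE in mk *. Qed.

Lemma card_first_values w k : (k <= n)%N -> #|first_values w k| = k.
Proof.
move=> kn; rewrite card_imset; last exact: perm_inj.
rewrite -sum1_card; under eq_bigl do rewrite inE.
by rewrite (big_ord_narrow kn) /= sum1_card card_ord.
Qed.

Lemma card_first_valuesS w (k : 'I_n.-1) : #|first_values w k.+1| = k.+1.
Proof. by rewrite card_first_values //; have := ltn_ord k; lia. Qed.

(** Apart from the pair of positions i, j, only pairs formed with a position m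
    between them can change: (i, m) and (m, j) both become inverted if w m lies
    between w i and w j, and otherwise keep their total number of inversions. *)
Lemma inv_number_tperm w (i j : 'I_n) : (i < j)%N -> (w i < w j)%N ->
  inv_number (tperm i j * w)%g =
  (inv_number w + 1 + 2 * #|[set m : 'I_n | (i < m < j) && (w i < w m < w j)]|)%N.
Proof.
move=> ij wij; set x := (_ * w)%g.
have neij : (j != i) by rewrite -val_eqE /=; lia.
pose g (s : 'S_n) (p q : 'I_n) : nat := (p < q)%N && (s q < s p)%N.
have invE (s : 'S_n) : inv_number s =
   (g s i j + \sum_(m | (m != i) && (m != j)) (g s i m + g s j m + (g s m i + g s m j))
    + (g s j i + \sum_(p | (p != i) && (p != j)) \sum_(q | (q != i) && (q != j)) g s p q))%N.
  have -> : inv_number s = \sum_p \sum_q g s p q.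
    rewrite pair_big /= /inv_number -sum1_card big_mkcond; apply: eq_bigr => -[p q] _.
    by rewrite inE /= /g; case: andP.
  have split2 (f : 'I_n -> nat) :
      \sum_p f p = f i + (f j + \sum_(p | (p != i) && (p != j)) f p).
    by rewrite (bigD1 i) //= (bigD1 j).
  rewrite split2 !(split2 (g s _)).
  under [X in _ + (_ + X)]eq_bigr do rewrite split2.
  rewrite !big_split /=.
  have -> : g s i i = 0 by rewrite /g ltnn.
  have -> : g s j j = 0 by rewrite /g ltnn.
  by lia.
have xi : x i = w j by rewrite permM tpermL.
have xj : x j = w i by rewrite permM tpermR.
have xm m : (m != i) && (m != j) -> x m = w m.
  by case/andP=> mi mj; rewrite permM tpermD // eq_sym.
rewrite (invE x) (invE w).
have -> : \sum_(p | (p != i) && (p != j)) \sum_(q | (q != i) && (q != j)) g x p q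
        = \sum_(p | (p != i) && (p != j)) \sum_(q | (q != i) && (q != j)) g w p q.
  by apply: eq_bigr => p /xm xp; apply: eq_bigr => q /xm xq; rewrite /g xp xq.
have -> : \sum_(m | (m != i) && (m != j)) (g x i m + g x j m + (g x m i + g x m j))
   = \sum_(m | (m != i) && (m != j)) (g w i m + g w j m + (g w m i + g w m j))
   + 2 * #|[set m : 'I_n | (i < m < j) && (w i < w m < w j)]|.
  have -> : #|[set m : 'I_n | (i < m < j) && (w i < w m < w j)]| =
            \sum_(m | (m != i) && (m != j)) ((i < m < j) && (w i < w m < w j)).
    rewrite -sum1_card big_mkcond [RHS]big_mkcond; apply: eq_bigr => m _.
    rewrite inE -!val_eqE /=; case: ifP; case: ifP => //; lia.
  rewrite big_distrr -big_split; apply: eq_bigr => m mij; rewrite /g xm // xi xj.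
  have wm1 : w m != w i :> nat by case/andP: mij => mi _; rewrite val_eqE (inj_eq perm_inj).
  have wm2 : w m != w j :> nat by case/andP: mij => _ mj; rewrite val_eqE (inj_eq perm_inj).
  by move: mij; rewrite -!val_eqE /=; lia.
have -> : g x i j = 1 by rewrite /g xi xj ij wij.
have -> : g x j i = 0 by rewrite /g [(j < i)%N]ltnNge (ltnW ij).
have -> : g w i j = 0 by rewrite /g [(w j < w i)%N]ltnNge (ltnW wij) andbF.
have -> : g w j i = 0 by rewrite /g [(j < i)%N]ltnNge (ltnW ij).
by lia.
Qed.

Lemma first_values_tperm_out w (i j : 'I_n) k :
  (k <= i)%N || (j < k)%N -> (i < j)%N ->
  first_values (tperm i j * w)%g k = first_values w k.
Proof.
move=> kij ij; apply/setP => y; apply/first_valuesP/first_valuesP => -[m mk ->].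
  by exists (tperm i j m); [move: mk; case: tpermP => // ->; lia | rewrite permM].
exists (tperm i j m); last by rewrite permM tpermK.
by move: mk; case: tpermP => // ->; lia.
Qed.

Lemma card_lt_first_values w k r : (k <= n)%N ->
  card_lt (first_values w k) r = \sum_(m < n | (m < k)%N) (w m < r)%N.
Proof.
move=> kn; rewrite /card_lt /first_values big_imset /=; last by move=> ? ? _ _ /perm_inj.
by apply: eq_bigl => m; rewrite inE.
Qed.

(** Between the positions i and j the swap replaces the value w i by w j. *)
Lemma card_lt_first_values_tperm w (i j : 'I_n) k r :
  (i < k <= j)%N ->
  (card_lt (first_values (tperm i j * w)%g k) r + (w i < r)
   = card_lt (first_values w k) r + (w j < r))%N.
Proof.
move=> ikj; have kn : (k <= n)%N by have := ltn_ord j; lia.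
rewrite !card_lt_first_values // (bigD1 i) /=; last by lia.
rewrite [in RHS](bigD1 i) /=; last by lia.
rewrite permM tpermL.
rewrite addnAC [in RHS]addnAC [(w i < r) + _]addnC; congr (_ + _)%N.
apply: eq_bigr => m /andP[mk mi].
by rewrite permM tpermD // 1?eq_sym // -val_eqE /=; lia.
Qed.

Definition total_depth u v : nat :=
  \sum_(k < n.-1) depth (first_values u k.+1) (first_values v k.+1).

Lemma total_depth_triangle w u v :
  (total_depth u v <= total_depth u w + total_depth w v)%N.
Proof. by rewrite -big_split; apply: leq_sum => k _; apply: depth_triangle. Qed.

Lemma total_depth_refl u : total_depth u u = 0%N.
Proof. by apply: big1 => k _; apply: depth_refl. Qed.

Lemma sum_interval a b m : (a <= b <= m)%N ->
  \sum_(k < m) (a <= k < b)%N = (b - a)%N.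
Proof.
move=> abm; rewrite -(@big_mkord _ _ _ m xpredT (fun k => (a <= k < b)%N : nat)).
rewrite (@big_cat_nat _ _ _ b) //=; last by lia.
rewrite [X in _ + X]big_nat_cond [X in _ + X]big1 ?addn0; last by move=> k; lia.
rewrite (@big_cat_nat _ _ _ a) //=; last by lia.
rewrite [X in X + _]big_nat_cond [X in X + _]big1 ?add0n; last by move=> k; lia.
rewrite big_nat_cond (eq_bigr (fun _ => 1)%N); last by move=> k; lia.
by rewrite -big_nat_cond sum_nat_const_nat muln1.
Qed.

(** The value w i moves up the circle to w j at the j - i levels between i and j,
    and wraps around exactly when w j is the smaller one. *)
Lemma total_depth_tperm w (i j : 'I_n) : (i < j)%N ->
  total_depth w (tperm i j * w)%g = if (w i < w j)%N then 0%N else (j - i)%N.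
Proof.
move=> ij; rewrite -(@sum_interval i j n.-1); last by have := ltn_ord j; lia.
rewrite /total_depth.
have E (k : 'I_n.-1) : depth (first_values w k.+1) (first_values (tperm i j * w)%g k.+1)
   = if (w i < w j)%N then 0 else (i <= k < j)%N.
  have [kij|kij] := boolP (i <= k < j)%N; last first.
    by rewrite first_values_tperm_out ?depth_refl; [case: ifP|lia|].
  have cE := @card_lt_first_values_tperm w i j k.+1 ^~ kij.
  have wij : w i != w j :> nat by rewrite val_eqE (inj_eq perm_inj) -val_eqE /=; lia.
  case: ifP => lt_w.
    by apply/eqP; rewrite -leqn0; apply/depth_leqP => s sn; have := cE s; lia.
  apply/eqP; rewrite eqn_leq; apply/andP; split.
    by apply/depth_leqP => s sn; have := cE s; lia.
  have := leq_depth (first_values w k.+1) (first_values (tperm i j * w)%g k.+1)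
    (ltnW (ltn_ord (w i))).
  by have := cE (w i); lia.
by under eq_bigr do rewrite E; case: ifP => // _; rewrite big1.
Qed.

(** Each edge has length 1 in the metric of [qbg_dist_depth]: going up it gains one
    inversion and does not wrap; going down it loses 2 (j - i) - 1 inversions and
    wraps at j - i levels. *)
Lemma qbg_edge_depth w x : qbg_edge w x ->
  (inv_number x + 2 * total_depth w x = inv_number w + 1)%N.
Proof.
case/existsP=> i /existsP[j /and3P[ij /eqP-> inv]].
rewrite total_depth_tperm //; case: ltngtP => wij.
- have := inv_number_tperm ij wij; lia.
- have := @inv_number_tperm (tperm i j * w)%g i j ij.
  rewrite !permM tpermL tpermR mulgA tperm2 mul1g => /(_ wij); lia.
- by move/val_inj/perm_inj: wij ij => ->; lia.
Qed.

Lemma qbg_walk_bound u v m : qbg_walk u v m ->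
  (inv_number v + 2 * total_depth u v <= inv_number u + m)%N.
Proof.
case/existsP=> -[p /= /eqP<-] /andP[].
elim: p u => [|x p IHp] u /= => [_ /eqP->|/andP[/qbg_edge_depth ux xp] xv].
  by rewrite total_depth_refl; lia.
by have := IHp x xp xv; have := total_depth_triangle x u v; lia.
Qed.

(** The values met when going up along the circle from [p], excluded, to [q]; it
    serves both for elements and for boundaries, whence natural numbers. *)
Definition cyclic_between (p q y : nat) : bool :=
  if (p < q)%N then (p < y <= q)%N else (p < y)%N || (y <= q)%N.

(** If w i < w j, the swap creates a single inversion.  If w i > w j, the values at
    the positions in between all lie between w j and w i, so the swap loses as many
    inversions as a transposition of i and j can. *)
Lemma qbg_edge_tperm w (i j : 'I_n) : (i < j)%N ->
  (forall m : 'I_n, (i < m < j)%N -> ~~ cyclic_between (w i) (w j) (w m)) ->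
  qbg_edge w (tperm i j * w)%g.
Proof.
move=> ij apart; apply/existsP; exists i; apply/existsP; exists j.
have neq_w (m l : 'I_n) : (m < l)%N -> w m != w l :> nat.
  by move=> ml; rewrite val_eqE (inj_eq perm_inj) -val_eqE /=; lia.
rewrite ij eqxx /=; case: (ltngtP (w i) (w j)) => wij; last by have := neq_w _ _ ij; lia.
  rewrite inv_number_tperm // [#|_|]eq_card0 ?muln0 ?addn0 ?eqxx // => m.
  rewrite inE; apply/negP => /andP[/apart wm lt]; move: wm lt.
  by rewrite /cyclic_between wij; lia.
have := @inv_number_tperm (tperm i j * w)%g i j ij.
rewrite !permM tpermL tpermR mulgA tperm2 mul1g => /(_ wij) ->.
suff -> : #|[set m : 'I_n | (i < m < j)%N &&
             (w j < (tperm i j * w)%g m < w i)%N]| = (j - i.+1)%N.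
  by apply/orP; right; apply/eqP; lia.
rewrite -(@sum_interval i.+1 j n); last by have := ltn_ord j; lia.
rewrite -sum1_card big_mkcond; apply: eq_bigr => m _; rewrite inE.
have [ij_m|//] := boolP (i < m < j)%N.
rewrite permM tpermD -?val_eqE /=; [|lia|lia].
have /= -> // : (w j < w m < w i)%N.
have wim := neq_w i m; have wmj := neq_w m j.
by have := apart _ ij_m; rewrite /cyclic_between; case: ifP; lia.
Qed.

(** At q + 1 the function F_B - F_A is at most [depth A B], and going back to r it
    decreases by the excess of B over A in the cyclic interval from r to q. *)
Lemma depth_slack (A B : {set 'I_n}) (q r : nat) : #|A| = #|B| -> (q < n)%N ->
  (#|A :&: cyclic_interval n r.+1 q.+1| < #|B :&: cyclic_interval n r.+1 q.+1|)%N ->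
  (card_lt B r < depth A B + card_lt A r)%N.
Proof.
move=> cAB qn; have := leq_depth A B qn.
have := card_cyclic_interval A r q.+1; have := card_cyclic_interval B r q.+1.
by case: ifP; lia.
Qed.

(** Replacing p by q in A raises F_B - F_A by 1 on the boundaries crossed on the way
    up from p to q, and lowers it by 1 everywhere if this way wraps.  Since the
    maximum is not attained on the crossed boundaries, it drops by the
    amount of the wrap, which bounds the depth from A to C. *)
Lemma depth_exchange (A B C : {set 'I_n}) (p q : 'I_n) :
  #|A| = #|B| -> #|C| = #|A| -> p != q ->
  (forall r, card_lt C r + (p < r) = card_lt A r + (q < r))%N ->
  (forall r, (r < n)%N -> cyclic_between p q r ->
     (card_lt B r < depth A B + card_lt A r)%N) ->
  (depth A C + depth C B <= depth A B)%N.
Proof.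
move=> cAB cCA; rewrite -val_eqE /= => neq_pq cE slack.
pose wraps : nat := (q < p)%N.
have AC : (depth A C <= wraps)%N.
  by apply/depth_leqP => s sn; have := cE s; rewrite /wraps; lia.
have wraps_le : (wraps <= depth A B)%N.
  rewrite /wraps; case: ltnP => // qp; have := slack 0; rewrite !card_lt0.
  have -> : cyclic_between p q 0 by rewrite /cyclic_between; case: ifP; lia.
  by have := ltn_ord p; lia.
suff CB : (depth C B <= depth A B - wraps)%N by lia.
apply/depth_leqP => s sn; have := cE s => cEs; have := leq_depth A B sn.
have [sP|sP] := boolP (cyclic_between p q s); last first.
  by move: sP; rewrite /wraps /cyclic_between; case: ifP; lia.
have [sn'|ns] := ltnP s n; first by have := slack s sn' sP; rewrite /wraps; lia.
have -> : s = n by lia.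
by rewrite !card_lt_all //; lia.
Qed.

(** The first step of a shortest walk: at the first position i where u and v differ,
    bring u i closer to v i by the first later value that lies on the way up from
    u i to v i. *)
Lemma qbg_step u v : u != v ->
  exists2 x, qbg_edge u x & (total_depth u x + total_depth x v <= total_depth u v)%N.
Proof.
move=> neq_uv; pose Q (m : 'I_n) := u m != v m.
have [i0 i0P] : exists i0, Q i0.
  apply/existsP; rewrite -negb_forall; apply: contra neq_uv => /forallP uv.
  by apply/eqP/permP => m; apply/eqP.
case: (@arg_minnP _ i0 Q (fun m => m) i0P) => {i0 i0P} i uvi imin.
have agree (m : 'I_n) : (m < i)%N -> u m = v m.
  by move=> mi; apply/eqP; apply: contraTT mi => /imin; rewrite -leqNgt.
have neq_uvi : u i != v i :> nat by rewrite val_eqE.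
pose P (j : 'I_n) := (i < j)%N && cyclic_between (u i) (v i) (u j).
(* The position of the value v i in u is a candidate. *)
have [j0 j0P] : exists j, P j.
  exists (u^-1 (v i))%g; rewrite /P permKV; apply/andP; split; last first.
    rewrite /cyclic_between; case: ifP; last by rewrite leqnn orbT.
    by rewrite leqnn => ->.
  rewrite ltnNge leq_eqVlt negb_or; apply/andP; split.
    by rewrite val_eqE -(inj_eq (@perm_inj _ u)) permKV eq_sym.
  apply/negP => lt; have := agree _ lt; rewrite permKV => /perm_inj E.
  by move: lt; rewrite -E ltnn.
case: (@arg_minnP _ j0 P (fun m => m) j0P) => {j0 j0P} j /andP[ij uj] jmin.
have apart (m : 'I_n) : (i < m < j)%N -> ~~ cyclic_between (u i) (v i) (u m).
  case/andP=> im mj; apply/negP => um; have := jmin m; rewrite /P im um.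
  by move=> /(_ isT); rewrite leqNgt mj.
exists (tperm i j * u)%g.
  apply: qbg_edge_tperm => // m /apart.
  by move: uj; rewrite /cyclic_between; do ! case: ifP; lia.
rewrite -big_split; apply: leq_sum => k _ /=.
have [ikj|kij] := boolP (i <= k < j)%N; last first.
  by rewrite first_values_tperm_out ?depth_refl //; lia.
have neq_ij : u i != u j by rewrite (inj_eq perm_inj) -val_eqE /=; lia.
have cE := @card_lt_first_values_tperm u i j k.+1 ^~ ikj.
apply: depth_exchange neq_ij cE _; rewrite ?card_first_valuesS // => r rn ruj.
set A := first_values u _; set B := first_values v _.
have rvi : cyclic_between (u i) (v i) r.
  by move: uj ruj; rewrite /cyclic_between; do ! case: ifP; lia.
apply: (depth_slack _ (ltn_ord (v i))); first by rewrite !card_first_valuesS.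
(* Among the first k + 1 values of u, those in the cyclic interval from r to v i
   sit before position i, where u and v agree; v has in addition the value v i. *)
pose I := cyclic_interval n r.+1 (v i).+1.
suff : A :&: I \proper B :&: I by exact: proper_card.
apply/properP; split.
  apply/subsetP => y /setIP[/first_valuesP[m mk ->] yr]; rewrite inE yr andbT.
  case: (ltngtP m i) => mi.
  - by apply/first_valuesP; exists m; rewrite ?agree.
  - have := apart m; move: yr rvi; rewrite inE /cyclic_between.
    by do ! case: ifP; lia.
  - move/val_inj: mi yr rvi => ->; rewrite inE /cyclic_between.
    by do ! case: ifP; lia.
exists (v i).
  rewrite inE; apply/andP; split; first by apply/first_valuesP; exists i => //; lia.
  by move: rvi; rewrite inE /cyclic_between; do ! case: ifP; lia.
apply/negP => /setIP[/first_valuesP[m mk E] _]; case: (ltngtP m i) => mi.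
- by move: E; rewrite agree // => /perm_inj E; move: mi; rewrite E ltnn.
- by have := apart m; rewrite -E /cyclic_between; case: ifP; lia.
- by move: neq_uvi; rewrite E (val_inj mi) eqxx.
Qed.

(** Each step of [qbg_step] lowers the right-hand side of the distance formula
    by 1; adding the bound n * n on the number of inversions makes it a
    natural number on which to induct. *)
Lemma qbg_walk_exists u v :
  exists2 m, qbg_walk u v m & (m + inv_number u <= inv_number v + 2 * total_depth u v)%N.
Proof.
have inv_bound w : (inv_number w <= n * n)%N.
  rewrite /inv_number (leq_trans (max_card _)) // card_prod !card_ord //.
have [d] := ubnP (2 * total_depth u v + (n * n - inv_number u)).
elim: d u => // d IHd u ud.
have [->|neuv] := eqVneq u v.
  by exists 0%N; [apply/existsP; exists [tuple]; rewrite /= eqxx | lia].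
have [x ux le_x] := qbg_step neuv; have := qbg_edge_depth ux => ex.
have := inv_bound x; have := inv_bound u => bu bx.
have [|m /existsP[p xp] le_m] := IHd x; first by lia.
exists m.+1; last by lia.
by apply/existsP; exists [tuple of x :: p]; rewrite /= ux.
Qed.

Theorem qbg_dist_depth u v :
  (qbg_dist u v + inv_number u = inv_number v + 2 * total_depth u v)%N.
Proof.
rewrite /qbg_dist; case: ex_minnP => m /qbg_walk_bound lo hi.
have [d /hi dm hd] := qbg_walk_exists u v; lia.
Qed.

(** Depth being subadditive at each k, equality of the total depths forces
    equality at every k, where [depth_between] applies. *)
Theorem tilted_intervalP (a : 'I_n.-1 -> 'I_n) u v w : tilted_le a u v ->
  reflect (forall k : 'I_n.-1,
             count_le (a k) (first_values u k.+1) (first_values w k.+1) /\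
             count_le (a k) (first_values w k.+1) (first_values v k.+1))
          (w \in tilted_interval u v).
Proof.
move/forallP=> le_uv.
have le_k (k : 'I_n.-1) : count_le (a k) (first_values u k.+1) (first_values v k.+1).
  apply: set_shift_le_count; last exact: le_uv.
  by rewrite !card_first_valuesS.
have an k : (a k <= n)%N := ltnW (ltn_ord (a k)).
have -> : (w \in tilted_interval u v) =
    (total_depth u w + total_depth w v == total_depth u v)%N.
  rewrite inE; have := qbg_dist_depth u w; have := qbg_dist_depth w v.
  by have := qbg_dist_depth u v; lia.
rewrite eq_sym -big_split /=; apply: (iffP eqP) => [E k|le_w].
  apply/(depth_between _ (an k) (le_k k)); rewrite eq_sym; move: k (erefl true) => k _.
  have := leqif_sum (fun (k : 'I_n.-1) (_ : true) => leqif_eq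
     (depth_triangle (first_values w k.+1) (first_values u k.+1) (first_values v k.+1))).
  by case=> _; rewrite -/(total_depth u v) E eqxx => /esym/forallP/(_ k).
by apply: eq_bigr => k _; apply/esym/eqP/(depth_between _ (an k) (le_k k)).
Qed.

End QuantumBruhat.

(** * Rows of a matrix as a matroid *)

Section RowMatroid.

Variables (K : fieldType) (n p : nat) (N : 'M[K]_(n, p)).
Implicit Types (S T U I : {set 'I_n}).

Definition set_rows S : 'M[K]_(#|S|, p) := rowsub (fun i : 'I_#|S| => enum_val i) N.

Lemma set_rows_subP S q (X : 'M[K]_(q, p)) :
  reflect {in S, forall i, (row i N <= X)%MS} (set_rows S <= X)%MS.
Proof.
apply: (iffP row_subP) => [le i iS|le i].
  by have := le (enum_rank_in iS i); rewrite row_rowsub enum_rankK_in.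
by rewrite row_rowsub; apply/le/enum_valP.
Qed.

Lemma row_set_rows S i : i \in S -> (row i N <= set_rows S)%MS.
Proof. by move: i; apply/set_rows_subP. Qed.

Lemma set_rowsS S T : S \subset T -> (set_rows S <= set_rows T)%MS.
Proof. by move/subsetP=> ST; apply/set_rows_subP => i /ST/row_set_rows. Qed.

Lemma set_rows_sub S : (set_rows S <= N)%MS.
Proof. by apply/set_rows_subP => i _; apply: row_sub. Qed.

Lemma set_rowsT : (N <= set_rows [set: 'I_n])%MS.
Proof. by apply/row_subP => i; apply/row_set_rows. Qed.

Lemma row_free_set0 : row_free (set_rows set0).
Proof. by rewrite /row_free eqn_leq rank_leq_row (@leq_trans 0) ?cards0. Qed.

(** The rank grows by at most one with each added row. *)
Lemma row_free_subset S T : S \subset T -> row_free (set_rows T) -> row_free (set_rows S).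
Proof.
move=> ST freeT; have : (set_rows T <= set_rows S + set_rows (T :\: S))%MS.
  apply/set_rows_subP => i iT; have [iS|iS] := boolP (i \in S).
    by apply: submx_trans (addsmxSl _ _); apply: row_set_rows.
  by apply: submx_trans (addsmxSr _ _); apply: row_set_rows; rewrite inE iS.
move/mxrankS; rewrite (eqP freeT) => /leq_trans/(_ (mxrank_adds_leqif _ _)).
rewrite -(cardsID S T) (setIidPr ST).
have := rank_leq_row (set_rows (T :\: S)); have := rank_leq_row (set_rows S).
by rewrite /row_free; lia.
Qed.

(** An independent set of rows that is maximal inside T spans all rows of T. *)
Lemma row_free_extend S T : S \subset T -> row_free (set_rows S) ->
  exists I, [/\ S \subset I, I \subset T, row_free (set_rows I) &
                (set_rows T <= set_rows I)%MS].
Proof.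
move=> ST freeS; pose P I := (I \subset T) && row_free (set_rows I).
have [|I /maxsetP[/andP[IT freeI] maxI] SI] := @maxset_exists _ P S.
  by rewrite /P ST.
exists I; split=> //; apply/set_rows_subP => i iT; apply/negPn/negP => ni.
have iI : i \notin I by apply: contra ni => /row_set_rows.
have ltI : (set_rows I < set_rows (i |: I))%MS.
  rewrite ltmxE set_rowsS ?subsetU1 //=; apply: contra ni => /(submx_trans _); apply.
  by apply: row_set_rows; rewrite setU11.
have E : i |: I = I.
  apply: maxI; last exact: subsetU1.
  rewrite /P subUset sub1set iT IT /row_free eqn_leq rank_leq_row /=.
  by apply: leq_trans (rank_ltmx ltI); rewrite (eqP freeI) cardsU1 iI.
by rewrite -E setU11 in iI.
Qed.

(** The rank of T is the largest size of its intersection with a basis: a maximal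
    independent subset of T extends to a basis. *)
Lemma rank_set_rows_leqP T c :
  reflect (forall I, #|I| = \rank N -> row_free (set_rows I) -> (#|I :&: T| <= c)%N)
          (\rank (set_rows T) <= c)%N.
Proof.
apply: (iffP idP) => [le_c I _ freeI|le_c].
  apply: leq_trans le_c; have freeIT := row_free_subset (subsetIl I T) freeI.
  by rewrite -(eqP freeIT) mxrankS // set_rowsS ?subsetIr.
have [I [_ IT freeI TI]] := row_free_extend (sub0set T) row_free_set0.
have [B [IB _ freeB]] := row_free_extend (subsetT I) freeI.
move=> /(submx_trans set_rowsT)/mxrankS; rewrite (eqP freeB) => leB.
have cB : #|B| = \rank N.
  by apply/eqP; rewrite eqn_leq leB -(eqP freeB) mxrankS // set_rows_sub.
apply: leq_trans (le_c B cB freeB); apply: leq_trans (mxrankS TI) _.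
by rewrite (eqP freeI) subset_leq_card // subsetI IB.
Qed.

(** Order the rows by [h].  Along the initial segments the rank must increase
    exactly when an element of U is met; so a row outside U depends on earlier rows,
    and by induction on the rows of U before it. *)
Lemma greedy_row_free (h : 'I_n -> nat) U : injective h -> #|U| = \rank N ->
  (forall y, \rank (set_rows [set x | (h x <= h y)%N]) =
             #|U :&: [set x | (h x <= h y)%N]|) ->
  row_free (set_rows U).
Proof.
move=> h_inj cU rkE; pose C d := [set x | (h x < d)%N].
have rkC d : \rank (set_rows (C d)) = #|U :&: C d|.
  have [->|[y0 y0P]] := set_0Vmem (C d).
    by rewrite setI0 (eqP row_free_set0).
  pose y := [arg max_(y > y0 in C d) h y].
  suff -> : C d = [set x | (h x <= h y)%N] by exact: rkE.
  rewrite /y; case: arg_maxnP => // {y0 y0P}y yP ymax.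
  apply/setP => x; apply/idP/idP => [/ymax|]; first by rewrite inE.
  by move: yP; rewrite !inE => yd xy; apply: leq_ltn_trans yd.
have CU d : (set_rows (C d) <= set_rows (U :&: C d))%MS.
  elim: d => [|d IHd]; first by apply/set_rows_subP => x; rewrite inE.
  have CS : C d \subset C d.+1 by apply/subsetP => x; rewrite !inE; lia.
  apply/set_rows_subP => x xC; have [xU|xU] := boolP (x \in U).
    by apply: row_set_rows; rewrite inE xU.
  apply: submx_trans (set_rowsS (setIS U CS)); apply: submx_trans IHd.
  have [xd|dx] := boolP (x \in C d); first exact: row_set_rows.
  have hx : h x = d by move: xC dx; rewrite !inE; lia.
  have EU : U :&: C d.+1 = U :&: C d.
    apply/setP => y; rewrite !inE; case: (boolP (y \in U)) => //= yU.
    rewrite ltnS leq_eqVlt -hx (inj_eq h_inj).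
    by case: eqP yU xU => // ->; move=> ->.
  have : (set_rows (C d.+1) <= set_rows (C d))%MS.
    by rewrite -(mxrank_leqif_sup (set_rowsS CS)).2 !rkC EU.
  by apply: submx_trans; apply: row_set_rows.
pose d := (\max_x h x).+1.
have dT : C d = [set: 'I_n] by apply/setP => x; rewrite !inE ltnS leq_bigmax.
have := CU d; rewrite dT setIT => /(submx_trans set_rowsT)/mxrankS.
by rewrite -cU /row_free eqn_leq rank_leq_row.
Qed.

End RowMatroid.

(** * Bases of the spaces of a flag *)

Section FlagBases.

Variables (K : fieldType) (n : nat) (M : 'M[K]_n).
Hypothesis unitM : M \in unitmx.
Implicit Types (I J S : {set 'I_n}) (k : nat).

(** The first k columns of M, padded by zeros so that the type does not depend
    on k. *)
Definition flag_step k : 'M[K]_n := (M *m pid_mx k)%R.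

Definition flag_basis k I : bool := (#|I| == k) && row_free (set_rows (flag_step k) I).

Lemma rank_flag_step k : (k <= n)%N -> \rank (flag_step k) = k.
Proof.
move=> kn; rewrite /flag_step (eqmxMfull _ _) ?rank_pid_mx //.
by rewrite row_full_unit.
Qed.

(** The square matrix of the minor and the padded rows have the same rank. *)
Lemma minor_neq0 I : (minor M I != 0)%R = flag_basis #|I| I.
Proof.
rewrite /flag_basis eqxx /= /minor -unitfE -unitmxE -row_free_unit.
set C := mxsub _ _ _.
have -> : set_rows (flag_step #|I|) I = (C *m (pid_mx #|I| : 'M_(#|I|, n)))%R.
  rewrite /set_rows /flag_step -mul_rowsub_mx; apply/matrixP => i j; rewrite !mxE.
  rewrite (bigID (fun l : 'I_n => (l < #|I|)%N)) /= [X in (_ + X)%R]big1 ?addr0.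
    rewrite (big_ord_narrow (card_set_ord I)); apply: eq_bigr => l _.
    by rewrite !mxE.
  by move=> l /negPf nl; rewrite !mxE nl andbF mulr0.
rewrite /row_free mxrankMfree // /row_free rank_pid_mx // card_set_ord //.
Qed.

(** Independence of rows survives the addition of a column, and the rank of the
    enlarged matrix leaves room for one more row. *)
Lemma flag_basis_up k I : flag_basis k I -> (k < n)%N ->
  exists2 J : {set 'I_n}, I \subset J & flag_basis k.+1 J.
Proof.
case/andP=> /eqP cI freeI kn.
have freeI' : row_free (set_rows (flag_step k.+1) I).
  have E : set_rows (flag_step k) I = (set_rows (flag_step k.+1) I *m pid_mx k)%R.
    rewrite /set_rows mul_rowsub_mx /flag_step -mulmxA mul_pid_mx.
    by rewrite (minn_idPr (leqnSn k)) (minn_idPr (ltnW kn)).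
  rewrite /row_free eqn_leq rank_leq_row -{1}(eqP freeI) E; exact: mxrankM_maxl.
have [J [IJ _ freeJ TJ]] := row_free_extend (subsetT I) freeI'.
exists J => //; rewrite /flag_basis freeJ andbT -(eqP freeJ).
rewrite -{2}(rank_flag_step kn) eqn_leq !mxrankS ?set_rows_sub //.
exact: submx_trans (set_rowsT _) TJ.
Qed.

(** Deleting a column lowers the rank of the rows I by at most one, because the
    deleted column is a summand of rank one. *)
Lemma flag_basis_down k I : (k < n)%N -> flag_basis k.+1 I ->
  exists2 J : {set 'I_n}, J \subset I & flag_basis k J.
Proof.
move=> kn /andP[/eqP cI freeI].
have [J [_ JI freeJ IJ]] := row_free_extend (sub0set I) (row_free_set0 (flag_step k)).
exists J => //; rewrite /flag_basis freeJ andbT eqn_leq; apply/andP; split.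
  by rewrite -(eqP freeJ) -{2}(rank_flag_step (ltnW kn)) mxrankS // set_rows_sub.
rewrite -(eqP freeJ); apply: leq_trans (mxrankS IJ).
have E : set_rows (flag_step k.+1) I = (set_rows (flag_step k) I
    + rowsub (fun i : 'I_#|I| => enum_val i) M *m delta_mx (Ordinal kn) (Ordinal kn))%R.
  rewrite /set_rows /flag_step -!mul_rowsub_mx -mulmxDr; congr (_ *m _)%R.
  apply/matrixP => i j; rewrite !mxE -!val_eqE /= !ltnS.
  by case: (ltngtP i k); case: (ltngtP j k); case: eqP; rewrite ?addr0 ?add0r //=; lia.
have := mxrank_add (set_rows (flag_step k) I)
  (rowsub (fun i : 'I_#|I| => enum_val i) M *m delta_mx (Ordinal kn) (Ordinal kn))%R.
rewrite -E (etrans (eqP freeI) cI).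
have := mxrankM_maxr (rowsub (fun i : 'I_#|I| => enum_val i) M)
  (delta_mx (Ordinal kn) (Ordinal kn)).
by rewrite mxrank_delta; lia.
Qed.

(** A partial enumeration of the rows whose initial segments are bases of the
    successive spaces of the flag; a complete one is a permutation w with
    P_w <> 0. *)
Definition basis_seq (s : seq 'I_n) : Prop :=
  uniq s /\ forall j, (j <= size s)%N -> flag_basis j [set x in take j s].

Lemma basis_seq_rcons s x : basis_seq s -> x \notin s ->
  flag_basis (size s).+1 [set y in rcons s x] -> basis_seq (rcons s x).
Proof.
move=> [us bs] xs bx; split; first by rewrite rcons_uniq xs.
move=> j; rewrite size_rcons leq_eqVlt ltnS => /predU1P[->|js].
  by rewrite take_oversize ?size_rcons.
by rewrite -cats1 takel_cat //; apply: bs.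
Qed.

Lemma flag_basis_subset1 k I J : flag_basis k I -> flag_basis k.+1 J -> I \subset J ->
  exists2 x, x \notin I & J = x |: I.
Proof.
move=> /andP[/eqP cI _] /andP[/eqP cJ _] IJ.
have /cards1P[x JI] : #|J :\: I| == 1%N.
  by have := cardsID I J; rewrite (setIidPr IJ) cI cJ; lia.
exists x; first by have : x \in J :\: I; [rewrite JI set11 | case/setDP].
apply/setP => y; rewrite -JI !inE; have := subsetP IJ y.
by case: (y \in I) => [/(_ isT)->|_]; rewrite ?orbF.
Qed.

Lemma basis_seq_ending k I : (k <= n)%N -> flag_basis k I ->
  exists2 s, basis_seq s & [set x in s] = I.
Proof.
elim: k I => [|k IHk] I kn bI.
  exists [::]; last by case/andP: bI => /eqP/cards0_eq -> _; apply/setP => x; rewrite !inE.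
  split=> // -[|j] // _; case/andP: (bI) => /eqP/cards0_eq I0 _.
  by congr (flag_basis 0 _): bI; rewrite I0; apply/setP => x; rewrite !inE.
have [J JI bJ] := flag_basis_down kn bI.
have [s sP sJ] := IHk J (ltnW kn) bJ.
have [x xJ IE] := flag_basis_subset1 bJ bI JI.
have xsI : [set y in rcons s x] = I.
  by rewrite IE -sJ; apply/setP => y; rewrite !inE mem_rcons inE.
exists (rcons s x) => //; apply: basis_seq_rcons => //.
  by move: xJ; rewrite -sJ inE.
have -> : size s = k by rewrite -(card_uniqP sP.1) -cardsE sJ; case/andP: bJ => /eqP.
by rewrite xsI.
Qed.

Lemma basis_seq_extend s : basis_seq s ->
  exists2 t, basis_seq (s ++ t) & size (s ++ t) = n.
Proof.
have [d] := ubnP (n - size s); elim: d s => // d IHd s sd sP.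
have sn : (size s <= n)%N.
  by rewrite -(card_uniqP sP.1) -[X in (_ <= X)%N](card_ord n) max_card.
move: sn; rewrite leq_eqVlt => /predU1P[sn|sn]; first by exists [::]; rewrite cats0.
have bs := sP.2 _ (leqnn _); rewrite take_size in bs.
have [J sJ bJ] := flag_basis_up bs sn.
have [x xs JE] := flag_basis_subset1 bs bJ sJ.
have [||t tP tn] := IHd (rcons s x); first by rewrite size_rcons; lia.
  apply: basis_seq_rcons => //; first by rewrite inE in xs.
  by congr (flag_basis _ _): bJ; rewrite JE; apply/setP => y; rewrite !inE mem_rcons inE.
by exists (x :: t); rewrite -cat_rcons.
Qed.

Lemma perm_of_seq (s : seq 'I_n) : uniq s -> size s = n ->
  exists w : 'S_n, forall k, first_values w k = [set x in take k s].
Proof.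
move=> us sn; have f_inj : injective (fun i : 'I_n => nth i s i).
  move=> i j; rewrite (set_nth_default i) ?sn // => /eqP.
  by rewrite nth_uniq ?sn // => /eqP/val_inj.
have [w wE] : exists w : 'S_n, forall i, w i = nth i s i.
  by exists (perm f_inj) => i; rewrite permE.
exists w => k; have sub : first_values w k \subset [set x in take k s].
  apply/subsetP => y /first_valuesP[i ik ->]; rewrite inE wE.
  by rewrite -(nth_take i ik) mem_nth // size_take sn; case: ifP.
apply/eqP; rewrite eqEcard sub /= cardsE (card_uniqP (take_uniq k us)) size_take sn.
have [kn|nk] := ltnP k n; first by rewrite card_first_values // ltnW.
suff -> : first_values w k = [set: 'I_n] by rewrite cardsT card_ord.
apply/setP => y; rewrite inE; apply/first_valuesP; exists (w^-1 y)%g; rewrite ?permKV //.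
by rewrite (leq_trans (ltn_ord _) nk).
Qed.

(** The flag matroid property: every basis of one space belongs to a complete
    chain of bases. *)
Lemma flag_basis_perm k I : (k <= n)%N -> flag_basis k I ->
  exists2 w : 'S_n, first_values w k = I &
    forall j, (j <= n)%N -> flag_basis j (first_values w j).
Proof.
move=> kn bI; have [s sP sI] := basis_seq_ending kn bI.
have [t tP tn] := basis_seq_extend sP.
have [w wE] := perm_of_seq tP.1 tn.
exists w => [|j jn]; last by rewrite wE; apply: tP.2; rewrite tn.
rewrite wE -sI take_cat.
have -> : k = size s.
  by case/andP: bI => /eqP cI _; rewrite -(card_uniqP sP.1) -cardsE sI cI.
by rewrite ltnn subnn take0 cats0.
Qed.

End FlagBases.

(** * Dimensions of coordinate projections *)

Section FlagRanks.

Variable K : fieldType.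

(** In a rank factorization of C the right factor is onto and the left one is
    injective. *)
Lemma dim_limg_mulmx m p (C : 'M[K]_(m, p)) :
  \dim (limg (linfun (fun x : 'cV[K]_p => C *m x)%R)) = \rank C.
Proof.
have [B BE] := row_freeP (row_base_free C).
have [D DE] : exists D, (D *m col_base C = 1%:M)%R by apply/row_fullP/col_base_full.
pose f := linfun (fun x : 'cV[K]_(\rank C) => col_base C *m x)%R.
have -> : limg (linfun (fun x : 'cV[K]_p => C *m x)%R) = limg f.
  apply/vspaceP => y; apply/memv_imgP/memv_imgP => -[x _ ->].
    exists (row_base C *m x)%R; rewrite ?memvf // !lfunE /= mulmxA mulmx_base //.
  exists (B *m x)%R; rewrite ?memvf // !lfunE /= mulmxA; congr (_ *m x)%R.
  by rewrite -[X in _ = (X *m B)%R](mulmx_base C) -mulmxA BE mulmx1.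
rewrite limg_dim_eq ?dimvf /dim /= ?muln1 //.
apply/eqP; rewrite -subv0; apply/subvP => x /memv_capP[_].
rewrite memv_ker lfunE /= memv0 => /eqP/(congr1 (mulmx D)).
by rewrite mulmxA DE mul1mx mulmx0 => ->.
Qed.

Variable n : nat.
Implicit Types (F : flag K n) (M : 'M[K]_n).

(** Both sides measure the span of the first k columns of M restricted to the
    coordinates in S. *)
Lemma dim_proj_rank F M S k : represents F M -> (k <= n)%N ->
  dim_proj S (flag_space F k) = \rank (set_rows (flag_step M k) S).
Proof.
case/andP=> _ /forallP span_M kn.
rewrite /dim_proj -[flag_space F k]/(flag_space F (Ordinal (kn : (k < n.+1)%N))).
rewrite (eqP (span_M _)) limg_span -dim_limg_mulmx; congr (\dim _).
set C := set_rows _ S; pose D := rowsub (fun i : 'I_#|S| => enum_val i) M.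
have CE : C = (D *m pid_mx k)%R by rewrite /C /D mul_rowsub_mx.
apply/eqP; rewrite eqEsubv; apply/andP; split.
  apply/span_subvP => y /mapP[z /mapP[j jk ->{z}] ->].
  move: jk; rewrite mem_filter => /andP[jk _].
  apply/memv_imgP; exists (delta_mx j 0)%R; rewrite ?memvf // !lfunE /= -colE.
  rewrite CE; apply/matrixP => i l; rewrite !mxE (bigD1 j) //= big1 ?addr0.
    by rewrite !mxE eqxx jk mulr1.
  by move=> m mj; rewrite !mxE val_eqE (negPf mj) mulr0.
apply/subvP => y /memv_imgP[x _ ->]; rewrite lfunE /= CE.
have -> : (D *m pid_mx k *m x = \sum_(j < n | (j < k)%N) x j 0 *: col j D)%R.
  apply/matrixP => i l; rewrite ord1 -mulmxA summxE mxE [RHS]big_mkcond.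
  apply: eq_bigr => j _; rewrite !mxE (bigD1 j) //= big1 ?addr0.
    by rewrite !mxE eqxx; case: ifP => _; rewrite ?mul1r ?mul0r ?mulr0 // mulrC.
  by move=> m mj; rewrite !mxE val_eqE eq_sym (negPf mj) mul0r.
apply: memv_suml => j jk; apply/memvZ/memv_span/mapP; exists (col j M).
  by apply: map_f; rewrite mem_filter mem_enum jk.
by rewrite lfunE /=; apply/matrixP => i l; rewrite !mxE.
Qed.

End FlagRanks.

(** * Tilted Richardson varieties *)

Section TiltedRichardson.

Variables (K : fieldType) (n : nat) (u v : 'S_n) (a : 'I_n.-1 -> 'I_n).
Implicit Types (F : flag K n) (w : 'S_n) (k : 'I_n.-1) (I : {set 'I_n}).

Lemma leq_predS k : (k.+1 <= n)%N.
Proof. by have := ltn_ord k; lia. Qed.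

Lemma flag_mxP F : represents F (flag_mx F).
Proof. exact: xchooseP. Qed.

Lemma unit_flag_mx F : flag_mx F \in unitmx.
Proof. by have /andP[] := flag_mxP F. Qed.

Lemma plucker_perm_neq0 F w :
  (plucker_perm F w != 0)%R <->
  forall k, flag_basis (flag_mx F) k.+1 (first_values w k.+1).
Proof.
have E k : (plucker F (first_values w k.+1) != 0)%R =
           flag_basis (flag_mx F) k.+1 (first_values w k.+1).
  by rewrite /plucker minor_neq0 card_first_valuesS.
split=> [/prodf_neq0 nz k|b]; first by rewrite -E nz.
by apply/prodf_neq0 => k _; rewrite E.
Qed.

Lemma dim_proj_leqP F S k c :
  (dim_proj S (flag_space F k.+1) <= c)%N <->
  forall I, flag_basis (flag_mx F) k.+1 I -> (#|I :&: S| <= c)%N.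
Proof.
have kn := leq_predS k.
rewrite (dim_proj_rank S (flag_mxP F) kn).
have rk := rank_flag_step (unit_flag_mx F) kn.
split=> [/rank_set_rows_leqP le I /andP[/eqP cI]|le].
  by apply: le; rewrite cI rk.
by apply/rank_set_rows_leqP => I cI freeI; apply: le; rewrite /flag_basis freeI cI rk eqxx.
Qed.

Lemma tilted_richardsonP F :
  tilted_richardson u v a F <->
  forall k I, flag_basis (flag_mx F) k.+1 I ->
    count_le (a k) (first_values u k.+1) I /\
    count_le (a k) I (first_values v k.+1).
Proof.
split=> [TF k I bI|bF k j].
  have /andP[/eqP cI _] := bI.
  split; [apply/count_le_initial|apply/count_le_final]; rewrite ?card_first_valuesS // => j;
    have [Tu Tv] := TF k j; [move/dim_proj_leqP: Tu | move/dim_proj_leqP: Tv]; exact.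
split; apply/dim_proj_leqP => I bI; have [Iu Iv] := bF k I bI;
  have /andP[/eqP cI _] := bI.
  by move/count_le_initial: Iu; apply; rewrite card_first_valuesS.
by move/count_le_final: Iv; apply; rewrite card_first_valuesS.
Qed.

Lemma tilted_richardson_plucker F : tilted_le a u v ->
  tilted_richardson u v a F <->
  forall w, w \notin tilted_interval u v -> plucker_perm F w = 0%R.
Proof.
move=> le_uv; split=> [/tilted_richardsonP TF w|PF].
  apply: contraNeq => /plucker_perm_neq0 bw; apply/(tilted_intervalP _ le_uv) => k.
  exact: TF.
apply/tilted_richardsonP => k I bI.
have [w wI bw] := flag_basis_perm (unit_flag_mx F) (leq_predS k) bI.
have : w \in tilted_interval u v.
  apply: contraT => /PF/eqP; apply: contraLR => _.
  by apply/plucker_perm_neq0 => l; apply/bw/leq_predS.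
by move/(tilted_intervalP _ le_uv)/(_ k); rewrite wI.
Qed.

(** The chains for [greedy_row_free] are the cyclic intervals from a_k upwards for
    u[k], and those from a_k - 1 downwards for v[k], so the second one uses the
    reversed ranking. *)
Lemma open_tilted_richardsonP F :
  open_tilted_richardson u v a F <->
  tilted_richardson u v a F /\ (plucker_perm F u * plucker_perm F v != 0)%R.
Proof.
rewrite mulf_eq0 negb_or; split=> [TF|[TF /andP[/plucker_perm_neq0 bu /plucker_perm_neq0 bv]] k j].
  split=> [k j|]; first by have [-> ->] := TF k j.
  have rkF k := rank_flag_step (unit_flag_mx F) (leq_predS k).
  apply/andP; split; apply/plucker_perm_neq0 => k;
    apply/andP; split; rewrite ?card_first_valuesS //.
  - apply: (@greedy_row_free _ _ _ _ (shift_rank (a k))); rewrite ?rkF ?card_first_valuesS //.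
      exact: shift_rank_inj.
    by move=> j; have [] := TF k j; rewrite (dim_proj_rank _ (flag_mxP F) (leq_predS k))
      cyclic_interval_initial.
  - apply: (@greedy_row_free _ _ _ _ (fun x => n - shift_rank (a k) x)%N);
      rewrite ?rkF ?card_first_valuesS //.
      move=> x y E; apply: (@shift_rank_inj _ (a k)).
      by have := ltn_shift_rank (a k) x; have := ltn_shift_rank (a k) y; lia.
    move=> j; have [_] := TF k j; rewrite (dim_proj_rank _ (flag_mxP F) (leq_predS k))
      cyclic_interval_final.
    suff -> : [set x | (n - shift_rank (a k) x <= n - shift_rank (a k) j)%N] =
              [set x | (shift_rank (a k) j <= shift_rank (a k) x)%N] by [].
    apply/setP => x; rewrite !inE.
    by have := ltn_shift_rank (a k) x; have := ltn_shift_rank (a k) j; lia.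
have [Tu Tv] := TF k j; split; apply/eqP; rewrite eqn_leq ?Tu ?Tv /=.
  exact: (dim_proj_leqP F _ k _).1 (leqnn _) _ (bu k).
exact: (dim_proj_leqP F _ k _).1 (leqnn _) _ (bv k).
Qed.

End TiltedRichardson.

Theorem theorem4p12 (R : realType) (n : nat) (u v : 'S_n)
    (a : 'I_n.-1 -> 'I_n) (le_uv : tilted_le a u v) :
  (@tilted_richardson R[i] n u v a =
     [set F : flag R[i] n |
        forall w : 'S_n, w \notin tilted_interval u v ->
          plucker_perm F w = 0%R] /\
   @open_tilted_richardson R[i] n u v a =
     tilted_richardson u v a `&`
     [set F : flag R[i] n |
        (plucker_perm F u * plucker_perm F v)%R != 0%R])%classic.
Proof.
split; apply/seteqP; split=> F.
- exact: (tilted_richardson_plucker F le_uv).1.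
- exact: (tilted_richardson_plucker F le_uv).2.
- exact: (@open_tilted_richardsonP _ _ u v a F).1.
- exact: (@open_tilted_richardsonP _ _ u v a F).2.
Qed.
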